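(* Let $q$ be a prime power and let $n,k,\ell$ be integers with $\ell\ge 0$ and $\ell+1\le k\le n-\ell-1$. Set $a=k-\ell$ and $b=n-k-\ell$. Then $$A^H_{n,k,\ell,q}=\alpha^H_{n,k,\ell,q}\cdot(q^{\ell+1}-1)\cdot A^H_{n,k,\ell+1,q},$$ where $$\alpha^H_{n,k,\ell,q}=\frac{q^{n-2\ell-1}(q^{\ell+1}+1)}{(q^{a}-(-1)^{a})(q^{b}-(-1)^{b})}.$$ Moreover, $\alpha^H_{n,k,\ell,q}>1$ for all such parameters except when $\ell=0$, both $a$ and $b$ are odd, and $\min(a,b)=1$ (equivalently, $\ell=0$, $n$ is even, and $k\in\{1,n-1\}$); in that exceptional case $$\alpha^H_{n,k,0,q}=\frac{q^{\max(a,b)}}{q^{\max(a,b)}+1}\in\left[\tfrac{q}{q+1},\,1\right).$$ In all cases, $\alpha^H_{n,k,\ell,q}\ge q/(q+1)\ge 2/3$.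
   Context: For a prime power $q$, the Hermitian inner product on $\mathbb{F}_{q^2}^n$ is $\langle \mathbf{x},\mathbf{y}\rangle_H=\sum_{i=1}^n x_i y_i^q$. For an $\mathbb{F}_{q^2}$-linear subspace $C\subseteq\mathbb{F}_{q^2}^n$, its Hermitian dual is $C^{\perp_H}=\{\mathbf{y}\in\mathbb{F}_{q^2}^n:\langle\mathbf{x},\mathbf{y}\rangle_H=0\ \forall\mathbf{x}\in C\}$ and its Hermitian hull is $\mathrm{Hull}_H(C)=C\cap C^{\perp_H}$. The number $A^H_{n,k,\ell,q}$ is the number of $k$-dimensional $\mathbb{F}_{q^2}$-subspaces $C\subseteq\mathbb{F}_{q^2}^n$ with $\dim\mathrm{Hull}_H(C)=\ell$. *)

(* Defs.v *)
From HB Require Import structures.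
From mathcomp Require Import all_boot all_order all_algebra all_field.

Set Implicit Arguments.
Unset Strict Implicit.
Unset Printing Implicit Defensive.

Import VectorInternalTheory GRing.Theory.
Local Open Scope ring_scope.

HB.instance Definition _ (F : finFieldType) (vT : vectType F) :=
  [Countable of {vspace vT} by <:].
HB.instance Definition _ (F : finFieldType) (vT : vectType F) :=
  [Finite of {vspace vT} by <:].

(* F is meant to be the field with q ^ 2 elements; q is a separate argument. *)
Definition hdot (F : finFieldType) (q n : nat) (x y : 'rV[F]_n) : F :=
  \sum_(i < n) x 0 i * y 0 i ^+ q.

(* The orthogonal set is already a subspace when #|F| = q ^ 2 (see
   mem_hdual); the span only serves to give it the type {vspace _}. *)
Definition hdual (F : finFieldType) (q n : nat) (C : {vspace 'rV[F]_n}) :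
    {vspace 'rV[F]_n} :=
  <<enum [set y : 'rV[F]_n | [forall x in C, hdot q x y == 0%R]]>>%VS.

Definition hhull (F : finFieldType) (q n : nat) (C : {vspace 'rV[F]_n}) :
    {vspace 'rV[F]_n} :=
  (C :&: hdual q C)%VS.

Definition AH (F : finFieldType) (n k l q : nat) : nat :=
  #|[set C : {vspace 'rV[F]_n} | (\dim C == k) && (\dim (hhull q C) == l)]|.

(* The subtractions in nat are exact when l + 1 <= k and k + l + 1 <= n. *)
Definition alphaH (n k l q : nat) : rat :=
  let a := (k - l)%N in
  let b := (n - k - l)%N in
  q%:R ^+ (n - 2 * l - 1) * (q%:R ^+ l.+1 + 1)
    / ((q%:R ^+ a - (-1) ^+ a) * (q%:R ^+ b - (-1) ^+ b)).

Lemma mem_hdual (F : finFieldType) (p e q n : nat) (C : {vspace 'rV[F]_n})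
    (y : 'rV[F]_n) :
  prime p -> q = (p ^ e)%N -> #|F| = (q ^ 2)%N ->
  (y \in hdual q C) = [forall x in C, hdot q x y == 0].
Proof.
move=> p_pr qE cardF.
have pF : p \in [pchar F].
  by apply: (@card_finPcharP _ p (e * 2)) => //; rewrite cardF qE -expnM.
have q_nat : [pchar F].-nat q.
  rewrite qE; apply/pnatP; first by rewrite expn_gt0 prime_gt0.
  by move=> r r_pr; rewrite Euclid_dvdX // dvdn_prime2 // => /andP[/eqP->].
have q_gt0 : (0 < q)%N by rewrite qE expn_gt0 prime_gt0.
apply/idP/idP => [|yP]; last by apply: memv_span; rewrite mem_enum inE.
move=> /(@coord_span _ _ _ (in_tuple _)) ->.
apply/forall_inP => x xC; rewrite /hdot.
under eq_bigr => i _.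
  rewrite summxE.
  rewrite (big_morph (fun z : F => z ^+ q) (id1 := 0) (op1 := +%R));
    [ | by move=> u v; rewrite exprDn_pchar | by rewrite expr0n gtn_eqF].
  rewrite big_distrr /=.
  over.
rewrite exchange_big /= big1 // => j _.
set s := enum _ in j *.
have : s`_j \in s by rewrite mem_nth.
rewrite mem_enum inE => /forall_inP/(_ x xC)/eqP.
rewrite /hdot => h0.
under eq_bigr => i _ do rewrite mxE exprMn mulrCA.
by rewrite -big_distrr /= h0 mulr0.
Qed.

(* Main.v *)
Require Import Defs.
From mathcomp Require Import all_boot all_order all_algebra.
From mathcomp Require Import all_field zify ring lra.

Import Order.TTheory GRing.Theory Num.Theory.
Local Open Scope ring_scope.

(** Write <x, y> for the Hermitian product and put s = (-1)^a, t = (-1)^b.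
    Codes of dimension k with hull dimension l, and codes of dimension k with
    hull dimension l + 1, are both compared with the same third family: the
    codes W of dimension k - 1 with hull dimension l.

    Let v be orthogonal to W, and C = W + <v>.  The modular law gives
    Hull C = Hull W + (<v> cap v^perp): if v is anisotropic the hull does not
    change, and if v is isotropic and outside W the hull gains the line of v.
    Conversely, for any u with <v, u> <> 0, intersecting with u^perp undoes
    the addition of v: (W + <v>) cap u^perp = W when W is orthogonal to u, and
    (C cap u^perp) + <v> = C when v is in C.  This yields two bijections.

    - Taking u = v: pairs (C, v) with v anisotropic in C, C of hull dimension
      l, correspond to pairs (W, v) with v anisotropic in W^perp
      ([count_anisotropic_extensions]).
    - With v isotropic: triples (D, v, u) with 0 <> v in Hull D, D of hull
      dimension l + 1, and <v, u> <> 0, correspond to triples (W, v, u) with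
      v in W^perp isotropic outside W, and u in W^perp with <v, u> <> 0
      ([count_isotropic_extensions]).

    The number of v, or of (v, u), depends only on dimensions: W^perp has
    dimension n - k + 1 and the same hull as W, and a space of dimension m + l
    whose radical has dimension l contains
    q^(2l+2m-1) + (-1)^m (q - 1) q^(2l+m-1) isotropic vectors
    ([card_isotropic]).  That count follows by splitting off anisotropic
    vectors one at a time, because the norm c |-> c^(q+1) takes each nonzero
    value fixed by Frobenius exactly q + 1 times ([card_norm_fibre]).

    Let A, A', P be the sizes of the three families.  After cancellation the
    bijections read
      A q^a (q^a - s) = P q^(b+1) (q^(b+1) + t),
      A' (q^(2l+2) - 1) q^(2a-2) = P (q^(b+1) + t) (q^b - t),
    and eliminating P gives the recurrence ([AH_hull_recurrence]).

    The bounds on alpha are elementary: its denominator exceeds q^(a+b) by at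
    most q^a + q^b + 1, which the factor q^(l+1) + 1 absorbs when l > 0 or
    when a and b are both at least 3; when l = 0 and one of a, b is even, the
    signs already make the denominator small enough ([alphaH_gt1]). *)

(** * Counting lemmas *)

Lemma card_dep_pairs (A B : finType) (P : pred A) (Q : A -> pred B) :
  #|[set x : A * B | P x.1 && Q x.1 x.2]|
  = (\sum_(a | P a) #|[set b | Q a b]|)%N.
Proof.
rewrite cardsE -sum1_card.
rewrite (eq_bigl (fun x : A * B => P x.1 && Q x.1 x.2)) //.
rewrite -(pair_big_dep P Q (fun _ _ => 1%N)).
by apply: eq_bigr => a _; rewrite sum1_card cardsE.
Qed.

(** The common fibre size [c] is rational because the closed formulas used
    below involve division by q and alternating signs. *)
Lemma card_dep_pairs_const {A B : finType} {P : pred A} {Q : A -> pred B}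
    (c : rat) :
  (forall a, P a -> #|[set b | Q a b]|%:R = c) ->
  #|[set x : A * B | P x.1 && Q x.1 x.2]|%:R = #|[set a | P a]|%:R * c.
Proof.
move=> Qc; rewrite card_dep_pairs natr_sum (eq_bigr (fun=> c)) //.
by rewrite sumr_const cardsE mulr_natl.
Qed.

Lemma card_eq_inverse {A B : finType} {S : {set A}} {T : {set B}}
    (f : A -> B) (g : B -> A) :
  (forall x, x \in S -> f x \in T /\ g (f x) = x) ->
  (forall y, y \in T -> g y \in S /\ f (g y) = y) ->
  #|S| = #|T|.
Proof.
move=> fP gP; have fK : {in S, cancel f g} by move=> x /fP[].
rewrite -(card_in_imset (can_in_inj fK)); apply: eq_card => y.
apply/imsetP/idP => [[x /fP[fxT _] ->] // | /gP[gyS gK]].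
by exists (g y).
Qed.

Lemma card_nth_roots_le {F : finFieldType} (m : nat) (t : F) :
  (#|[set c : F | c ^+ m.+1 == t]| <= m.+1)%N.
Proof.
have szP : size ('X^(m.+1) - t%:P : {poly F}) = m.+2 by rewrite size_XnsubC.
rewrite cardE -ltnS -[m.+2 in X in (_ < X)%N]szP max_poly_roots ?enum_uniq //.
  by rewrite -size_poly_gt0 szP.
apply/allP=> c; rewrite mem_enum inE => /eqP ct.
by rewrite rootE !hornerE ct subrr.
Qed.

Lemma dim_add_line {K : fieldType} {vT : vectType K}
    (W : {vspace vT}) (v : vT) :
  v \notin W -> \dim (W + <[v]>) = (\dim W).+1.
Proof.
move=> vW; have v0 : v != 0 by apply: contraNneq vW => ->; rewrite mem0v.
rewrite dimv_disjoint_sum; first by rewrite dim_vline v0 addn1.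
apply/eqP; rewrite -subv0; apply/subvP => x /memv_capP[xW /vlineP[c xE]].
case: (eqVneq c 0) xE => [-> -> | c0 xE]; first by rewrite scale0r mem0v.
by case/negP: vW; rewrite -(scalerK c0 v) -xE memvZ.
Qed.

(** * The Hermitian form and its orthogonal complements *)

Section HermitianSpace.

Variables (F : finFieldType) (p e q n : nat).
Hypotheses (p_prime : prime p) (e_gt0 : (0 < e)%N) (qE : q = (p ^ e)%N).
Hypothesis cardF : #|F| = (q ^ 2)%N.

Implicit Types (x y u v w : 'rV[F]_n) (C D U W : {vspace 'rV[F]_n}).

Local Notation "<| x , y |>" := (hdot q x y) (at level 0).
Local Notation Q := (q%:R : rat).

Lemma q_gt1 : (1 < q)%N.
Proof. by rewrite qE -(exp1n e) ltn_exp2r // prime_gt1. Qed.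

Let q_gt0 : (0 < q)%N := ltnW q_gt1.

Let Q_gt1 : 1 < Q.
Proof. by rewrite ltr1n q_gt1. Qed.

Let Q_gt0 : 0 < Q := lt_trans ltr01 Q_gt1.

Let Q_neq0 : Q != 0 := lt0r_neq0 Q_gt0.

Lemma frobD (a b : F) : (a + b) ^+ q = a ^+ q + b ^+ q.
Proof.
have pF : p \in [pchar F].
  by apply: (@card_finPcharP _ p (e * 2)) => //; rewrite cardF qE -expnM.
apply: exprDn_pchar; rewrite qE; apply/pnatP.
  by rewrite expn_gt0 prime_gt0.
by move=> r r_pr; rewrite Euclid_dvdX // dvdn_prime2 // => /andP[/eqP->].
Qed.

Lemma frobK (a : F) : (a ^+ q) ^+ q = a.
Proof. by rewrite -exprM mulnn -cardF expf_card. Qed.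

Lemma frob0 : (0 : F) ^+ q = 0.
Proof. by rewrite expr0n gtn_eqF. Qed.

Lemma frob_sum (I : Type) (r : seq I) (P : pred I) (f : I -> F) :
  (\sum_(i <- r | P i) f i) ^+ q = \sum_(i <- r | P i) f i ^+ q.
Proof. exact: (big_morph (fun a => a ^+ q) frobD frob0). Qed.

(** Hermitian symmetry, thanks to which additivity on the right and the
    symmetry of orthogonality follow from additivity on the left. *)
Lemma hdot_frob x y : <|x, y|> ^+ q = <|y, x|>.
Proof.
rewrite frob_sum; apply: eq_bigr => i _.
by rewrite exprMn frobK mulrC.
Qed.

Lemma hdot_eq0C x y : (<|x, y|> == 0) = (<|y, x|> == 0).
Proof. by rewrite -(hdot_frob x y) expf_eq0 q_gt0. Qed.

Lemma hdotDl x y w : <|x + y, w|> = <|x, w|> + <|y, w|>.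
Proof.
by rewrite -big_split; apply: eq_bigr => i _; rewrite mxE mulrDl.
Qed.

Lemma hdotZl (c : F) x w : <|c *: x, w|> = c * <|x, w|>.
Proof.
by rewrite [in RHS]/hdot mulr_sumr; apply: eq_bigr => i _; rewrite mxE mulrA.
Qed.

Lemma hdotDr x y w : <|w, x + y|> = <|w, x|> + <|w, y|>.
Proof. by rewrite -3!(hdot_frob _ w) hdotDl frobD. Qed.

Lemma hdotZr (c : F) x w : <|w, c *: x|> = c ^+ q * <|w, x|>.
Proof. by rewrite -2!(hdot_frob _ w) hdotZl exprMn. Qed.

Lemma hdot_delta x (i : 'I_n) : <|x, delta_mx 0 i|> = x 0 i.
Proof.
rewrite /hdot (bigD1 i) //= mxE !eqxx expr1n mulr1 big1 ?addr0 // => j ji.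
by rewrite mxE (negbTE ji) andbF frob0 mulr0.
Qed.

Lemma hdualP {C y} :
  reflect (forall x, x \in C -> <|x, y|> = 0) (y \in hdual q C).
Proof.
rewrite (mem_hdual _ _ p_prime qE cardF).
apply: (iffP forall_inP) => Cy x /Cy; [exact: eqP | by move=> ->].
Qed.

Lemma mem_hdual_line v y : (y \in hdual q <[v]>) = (<|v, y|> == 0).
Proof.
apply/hdualP/eqP => [-> // | vy0 _ /vlineP[c ->]]; first exact: memv_line.
by rewrite hdotZl vy0 mulr0.
Qed.

Lemma hdualD C D : hdual q (C + D) = (hdual q C :&: hdual q D)%VS.
Proof.
apply/vspaceP => y; rewrite memv_cap.
apply/hdualP/andP => [CDy | [/hdualP Cy /hdualP Dy] x]; last first.
  by case/memv_addP=> c cC [d dD ->]; rewrite hdotDl Cy // Dy // addr0.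
by split; apply/hdualP => x xC; apply: CDy; apply: subvP x xC;
  rewrite ?addvSl ?addvSr.
Qed.

Lemma hdual_sub C D : (C <= hdual q D)%VS = (D <= hdual q C)%VS.
Proof.
apply/subvP/subvP => sub x xC; apply/hdualP => y /sub /hdualP/(_ _ xC)/eqP;
  by rewrite hdot_eq0C => /eqP.
Qed.

Lemma dimv_rV : \dim {:'rV[F]_n} = n.
Proof. by rewrite dimvf /dim /= mul1n. Qed.

Lemma dimv_rV_le C : (\dim C <= n)%N.
Proof. by have := dimvS (subvf C); rewrite dimv_rV. Qed.

Lemma hdual_fullv : hdual q {:'rV[F]_n} = 0%VS.
Proof.
apply/eqP; rewrite -subv0; apply/subvP => y /hdualP y0.
rewrite memv0; apply/eqP/rowP => i; rewrite mxE.
have /eqP := y0 _ (memvf (delta_mx 0 i)).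
by rewrite hdot_eq0C hdot_delta => /eqP.
Qed.

(** The orthogonal complement is cut out by dim C linear equations.  The form
    is only semilinear in its second argument, so the equations are written
    for <y, b> with b in a basis of C, that is with conjugated coefficients. *)
Lemma dim_hdual_ge C : (n - \dim C <= \dim (hdual q C))%N.
Proof.
pose M : 'M[F]_(n, \dim C) := \matrix_(j, i) ((vbasis C)`_i 0 j) ^+ q.
pose f : 'Hom('rV[F]_n, 'rV[F]_(\dim C)) := linfun (mulmxr M).
have ker_sub : (lker f <= hdual q C)%VS.
  apply/subvP => y; rewrite memv_ker lfunE /= => /eqP/rowP yM0.
  rewrite memvE hdual_sub -(span_basis (vbasisP C)).
  apply/span_subvP => x /(nthP 0)[i]; rewrite size_tuple => lt_i <-.
  rewrite mem_hdual_line; apply/eqP.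
  have := yM0 (Ordinal lt_i); rewrite !mxE => <-.
  by apply: eq_bigr => j _; rewrite mxE.
rewrite leq_subLR -{1}dimv_rV -(limg_ker_dim f fullv) capfv addnC leq_add //.
  by rewrite (leq_trans (dimvS (subvf _))) // dimvf /dim /= mul1n.
exact: dimvS.
Qed.

(** The lower bound holds for C and for a complement of C, whose orthogonals
    meet in 0 because the form is nondegenerate; as the two lower bounds add
    up to n, both are equalities. *)
Lemma dim_hdual C : \dim (hdual q C) = (n - \dim C)%N.
Proof.
have := dimv_sum_cap (hdual q C) (hdual q C^C).
rewrite -hdualD addv_complf hdual_fullv dimv0 addn0 => dimD.
have := dimv_rV_le (hdual q C + hdual q C^C); have := dimv_rV_le C.
have := dim_hdual_ge C; have := dim_hdual_ge C^C.
by rewrite dimD dimv_compl dimv_rV; lia.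
Qed.

Lemma hdualK C : hdual q (hdual q C) = C.
Proof.
apply/esym/eqP; rewrite eqEdim hdual_sub subvv !dim_hdual /=.
by rewrite subKn ?dimv_rV_le.
Qed.

Lemma hhull_hdual C : hhull q (hdual q C) = hhull q C.
Proof. by rewrite /hhull hdualK capvC. Qed.

Lemma hhull_sub C : (hhull q C <= C)%VS.
Proof. exact: capvSl. Qed.

(** * Hulls and extensions by one vector *)

(** Two applications of the modular law: <v> lies in the orthogonal of W, and
    Hull W lies in the orthogonal of v. *)
Lemma hhull_add_orth W v : v \in hdual q W ->
  hhull q (W + <[v]>) = (hhull q W + (<[v]> :&: hdual q <[v]>))%VS.
Proof.
move=> vW.
have sub_vW : (<[v]> <= hdual q W)%VS by rewrite -memvE.
rewrite /hhull hdualD capvA (capvC _ (hdual q W)) -vspace_modr //.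
rewrite (capvC (hdual q W)) -vspace_modl //.
by rewrite (subv_trans (capvSl _ _)) // hdual_sub.
Qed.

Lemma hhull_add_anisotropic W v : v \in hdual q W -> <|v, v|> != 0 ->
  hhull q (W + <[v]>) = hhull q W.
Proof.
move=> vW vv0; rewrite hhull_add_orth //.
suff -> : (<[v]> :&: hdual q <[v]> = 0)%VS by rewrite addv0.
apply/eqP; rewrite -subv0; apply/subvP => x /memv_capP[/vlineP[c ->]].
rewrite mem_hdual_line hdotZr mulf_eq0 (negbTE vv0) orbF expf_eq0.
by case/andP=> _ /eqP->; rewrite scale0r mem0v.
Qed.

Lemma hhull_add_isotropic W v : v \in hdual q W -> <|v, v|> = 0 ->
  hhull q (W + <[v]>) = (hhull q W + <[v]>)%VS.
Proof.
move=> vW vv0; rewrite hhull_add_orth //.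
by congr (_ + _)%VS; apply/capv_idPl; rewrite -memvE mem_hdual_line vv0.
Qed.

(** With the next lemma: adding the line of v and intersecting with the
    hyperplane orthogonal to u are mutually inverse whenever <v, u> <> 0. *)
Lemma add_line_capK W u v : (W <= hdual q <[u]>)%VS -> <|v, u|> != 0 ->
  ((W + <[v]>) :&: hdual q <[u]> = W)%VS.
Proof.
move=> Wu vu0; rewrite -vspace_modl //.
suff -> : (<[v]> :&: hdual q <[u]> = 0)%VS by rewrite addv0.
apply/eqP; rewrite -subv0; apply/subvP => x /memv_capP[/vlineP[c ->]].
rewrite mem_hdual_line hdotZr mulf_eq0 hdot_eq0C (negbTE vu0) orbF.
by rewrite expf_eq0 => /andP[_ /eqP->]; rewrite scale0r mem0v.
Qed.

Lemma capv_add_lineK C u v : v \in C -> <|v, u|> != 0 ->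
  (C :&: hdual q <[u]> + <[v]> = C)%VS.
Proof.
move=> vC vu0; rewrite vspace_modr -?memvE //; apply/capv_idPl.
suff -> : (hdual q <[u]> + <[v]> = fullv)%VS by rewrite subvf.
have v_notin : v \notin hdual q <[u]> by rewrite mem_hdual_line hdot_eq0C.
have u0 : u != 0.
  apply: contraNneq vu0 => ->.
  by rewrite -(scale0r v) hdotZr frob0 mul0r.
apply/eqP; rewrite eqEdim subvf dim_add_line // dim_hdual dim_vline u0 dimv_rV.
by lia.
Qed.

Lemma dim_cap_perp C u v : v \in C -> <|v, u|> != 0 ->
  (\dim (C :&: hdual q <[u]>)).+1 = \dim C.
Proof.
move=> vC vu0; rewrite -(dim_add_line _ v) ?capv_add_lineK //.
by rewrite memv_cap mem_hdual_line hdot_eq0C (negbTE vu0) andbF.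
Qed.

(** * Counting isotropic vectors *)

Lemma card_in_vspace C : #|[set v | v \in C]| = ((q ^ 2) ^ \dim C)%N.
Proof. by rewrite cardsE card_vspace cardF. Qed.

Lemma card_neq0 : #|[set c : F | c != 0]| = (q ^ 2 - 1)%N.
Proof.
rewrite -cardF subn1 -(cardsC1 (0 : F)).
by apply: eq_card => c; rewrite !inE.
Qed.

(** A polynomial of degree q + 1 has at most q + 1 roots, and the norm maps
    the q^2 - 1 nonzero scalars into the at most q - 1 roots of X^(q-1) - 1.
    As (q + 1)(q - 1) = q^2 - 1, no fibre can be smaller than the bound. *)
Lemma card_norm_fibre (t : F) : t != 0 -> t ^+ q = t ->
  #|[set c : F | c ^+ q.+1 == t]| = q.+1.
Proof.
have [q' q'E] : exists q', q = q'.+2 by exists q.-2; have := q_gt1; lia.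
move=> t0 tq; pose T := [set s : F | s ^+ q.-1 == 1].
have cardT : (#|T| <= q.-1)%N.
  have -> : q.-1 = q'.+1 by rewrite q'E.
  by rewrite /T q'E card_nth_roots_le.
have predq1 (s : F) : s != 0 -> (s ^+ q.-1 == 1) = (s ^+ q == s).
  by move=> s0; rewrite -(inj_eq (mulfI s0)) mulr1 -exprS prednK.
have tT : t \in T by rewrite inE predq1 // tq.
have sumT : (\sum_(s in T) #|[set c : F | c ^+ q.+1 == s]| = q ^ 2 - 1)%N.
  rewrite -card_neq0 -[RHS]sum1_card; apply/esym.
  rewrite (partition_big (fun c : F => c ^+ q.+1) (mem T)) /=; last first.
    move=> c; rewrite !inE => c0; rewrite predq1 ?expf_neq0 //.
    by rewrite -exprM mulnC exprM exprSr frobK -exprS.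
  apply: eq_bigr => s; rewrite inE => sT; rewrite -sum1_card.
  apply: eq_bigl => c; rewrite !inE.
  case: (_ =P s) => [cs|_]; rewrite ?andbF // andbT.
  apply: contraTneq sT => c0; rewrite -cs c0 exprS mul0r q'E expr0n /=.
  by rewrite eq_sym oner_eq0.
apply/eqP; rewrite eqn_leq card_nth_roots_le /= leqNgt; apply/negP => lt_t.
move: sumT; rewrite (bigD1 t) //= => sumT.
have : (\sum_(s in T | s != t) #|[set c : F | c ^+ q.+1 == s]|
        <= \sum_(s in T | s != t) q.+1)%N.
  by apply: leq_sum => s _; apply: card_nth_roots_le.
rewrite sum_nat_const => le_sum.
have cardTt : #|[pred s in T | s != t]| = #|T|.-1.
  by rewrite (cardD1 t T) tT /=; apply: eq_card => s; rewrite !inE andbC.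
have T_gt0 : (0 < #|T|)%N by apply/card_gt0P; exists t.
move: le_sum; rewrite cardTt => le_sum.
have : (#|T|.-1 * q.+1 <= q.-2 * q.+1)%N by rewrite leq_mul2r; lia.
by rewrite q'E /= in sumT lt_t le_sum *; nia.
Qed.

Lemma nonorth_witness U v : v \notin hdual q U ->
  exists2 u, u \in U & <|u, v|> != 0.
Proof.
rewrite (mem_hdual _ _ p_prime qE cardF) negb_forall_in.
by case/exists_inP => u uU uv0; exists u.
Qed.

Definition nonperp U v := [set u | (u \in U) && (<|v, u|> != 0)].

Lemma card_nonperp U v : v \notin hdual q U ->
  #|nonperp U v|%:R = Q ^+ (2 * \dim U) * (1 - Q ^- 2).
Proof.
case/nonorth_witness => u uU uv0.
have dimE := dim_cap_perp U v u uU uv0.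
have := cardsID [set w | w \in hdual q <[v]>] [set w | w \in U].
have -> : [set w | w \in U] :&: [set w | w \in hdual q <[v]>]
        = [set w | w \in (U :&: hdual q <[v]>)%VS].
  by apply/setP => w; rewrite !inE memv_cap.
have -> : [set w | w \in U] :\: [set w | w \in hdual q <[v]>] = nonperp U v.
  by apply/setP => w; rewrite !inE mem_hdual_line andbC.
rewrite !card_in_vspace -dimE => /(congr1 (fun k => k%:R : rat)).
rewrite natrD !natrX -!exprM => /(canRL (addKr _)) ->.
by rewrite mulnS addnC exprD mulrBr mulr1 mulfK ?expf_neq0 // addrC.
Qed.

Definition nonperp_pairs (X : {set 'rV[F]_n}) U :=
  [set x : 'rV[F]_n * 'rV[F]_n | (x.1 \in X) && (x.2 \in nonperp U x.1)].

Lemma card_nonperp_pairs (X : {set 'rV[F]_n}) U :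
  {in X, forall v, v \notin hdual q U} ->
  #|nonperp_pairs X U|%:R = #|X|%:R * (Q ^+ (2 * \dim U) * (1 - Q ^- 2)).
Proof.
move=> XU; rewrite (card_dep_pairs_const (P := mem X)
    (Q := fun v => mem (nonperp U v)) (Q ^+ (2 * \dim U) * (1 - Q ^- 2))).
  by congr (_%:R * _); apply: eq_card => v; rewrite inE.
move=> v /XU/card_nonperp <-; congr _%:R.
by apply: eq_card => u; rewrite inE.
Qed.

Definition isotropic U := [set v | (v \in U) && (<|v, v|> == 0)].

Definition anisotropic U := [set v | (v \in U) && (<|v, v|> != 0)].

Lemma card_isotropicD U :
  (#|isotropic U| + #|anisotropic U| = (q ^ 2) ^ \dim U)%N.
Proof.
rewrite -card_in_vspace -[RHS](cardsID (isotropic U)).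
congr (_ + _)%N; apply: eq_card => v; rewrite !inE.
  by rewrite andbA andbb.
by rewrite [RHS]andbC; case: (v \in U).
Qed.

(** Polarization.  If every vector of U were isotropic while <x, y> <> 0,
    expanding <cx + y, cx + y> = 0 with c = s / <x, y> would give s + s^q = 0
    for each scalar s, hence q^2 - 1 roots of X^(q-1) + 1. *)
Lemma exists_anisotropic U : ~~ (U <= hdual q U)%VS ->
  exists2 v, v \in U & <|v, v|> != 0.
Proof.
move=> notU; apply/exists_inP; apply: contraNT notU.
rewrite negb_exists_in => /forall_inP iso.
have h0 v : v \in U -> <|v, v|> = 0 by move=> /iso; rewrite negbK => /eqP.
apply/subvP => y yU; apply/hdualP => x xU; apply/eqP; apply/negPn/negP => xy0.
have trace0 (s : F) : s + s ^+ q = 0.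
  pose c := s / <|x, y|>.
  have := h0 (c *: x + y) (memvD (memvZ _ xU) yU).
  rewrite hdotDl !hdotDr !hdotZl !hdotZr !h0 // !mulr0 add0r addr0.
  by rewrite -(hdot_frob x y) -exprMn /c divfK.
have [q' q'E] : exists q', q = q'.+2 by exists q.-2; have := q_gt1; lia.
have := card_nth_roots_le q' (-1 : F).
have -> : [set c : F | c ^+ q'.+1 == -1] = [set c : F | c != 0].
  apply/setP => c; rewrite !inE; apply/eqP/idP => [c1 | c0].
    apply: contra_eq_neq c1 => ->.
    by rewrite expr0n /= eq_sym oppr_eq0 oner_eq0.
  apply: (mulfI c0); rewrite -exprS -q'E mulrN1; apply/eqP.
  by rewrite -addr_eq0 addrC trace0.
by rewrite card_neq0 q'E; nia.
Qed.

(** A vector u + c v of U + <v> is isotropic when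
    c^(q+1) = - <u, u> / <v, v>.  The right-hand side is fixed by Frobenius,
    so there are q + 1 such c when u is anisotropic; otherwise only c = 0. *)
Lemma card_isotropic_split U v : v \in hdual q U -> <|v, v|> != 0 ->
  (#|isotropic (U + <[v]>)| + q * #|isotropic U|
   = q.+1 * (q ^ 2) ^ \dim U)%N.
Proof.
move=> vU vv0; have uv0 u : u \in U -> <|u, v|> = 0 by move/hdualP: vU; apply.
have vu0 u : u \in U -> <|v, u|> = 0.
  by move=> /uv0/eqP; rewrite hdot_eq0C => /eqP.
have normE u c : u \in U ->
    <|u + c *: v, u + c *: v|> = <|u, u|> + c ^+ q.+1 * <|v, v|>.
  move=> uU; rewrite hdotDl !hdotDr !hdotZl !hdotZr uv0 // vu0 // exprS.
  by rewrite !mulr0 addr0 add0r mulrA.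
pose coef w := <|w, v|> / <|v, v|>.
have coefE u c : u \in U -> coef (u + c *: v) = c.
  by move=> uU; rewrite /coef hdotDl uv0 // hdotZl add0r mulfK.
pose fibre u := [pred c : F | <|u + c *: v, u + c *: v|> == 0].
have fibreE u : u \in U ->
    #|[set c | fibre u c]| = if <|u, u|> == 0 then 1%N else q.+1.
  move=> uU; case: ifP => [/eqP uu0 | /negbT uu0].
    rewrite -[RHS](cards1 (0 : F)); apply: eq_card => c; rewrite !inE /=.
    by rewrite normE // uu0 add0r mulf_eq0 (negbTE vv0) orbF expf_eq0.
  rewrite -(card_norm_fibre (- <|u, u|> / <|v, v|>)).
  - apply: eq_card => c; rewrite !inE /= normE //.
    by rewrite -[in RHS](inj_eq (mulIf vv0)) divfK // addrC addr_eq0.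
  - by rewrite mulf_neq0 ?oppr_eq0 ?invr_eq0.
  - rewrite exprMn exprVn !hdot_frob -mulN1r exprMn hdot_frob.
    congr (_ * _ / _); apply: (addIr (1 ^+ q)).
    by rewrite -frobD addNr frob0 expr1n addNr.
have -> : #|isotropic (U + <[v]>)|
        = #|[set x : _ * F | (x.1 \in U) && fibre x.1 x.2]|.
  pose f w := (w - coef w *: v, coef w).
  pose g (x : 'rV[F]_n * F) := x.1 + x.2 *: v.
  apply: (card_eq_inverse f g) => [w | [u c]]; rewrite /f /g /=.
    rewrite inE => /andP[/memv_addP[u uU [_ /vlineP[c ->] ->]] w0].
    by rewrite !inE /= coefE // addrK uU.
  rewrite !inE /= => /andP[uU uc0]; rewrite coefE // addrK uc0.
  by rewrite memv_add // memvZ ?memv_line.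
rewrite (card_dep_pairs _ _ (fun u => u \in U) fibre) (eq_bigr _ fibreE).
rewrite (bigID (fun u => <|u, u|> == 0)) /=.
rewrite (eq_bigr (fun=> 1%N)); last by move=> u /andP[_ ->].
rewrite [X in (_ + X + _)%N](eq_bigr (fun=> q.+1)); last first.
  by move=> u /andP[_ /negbTE ->].
rewrite !sum_nat_const -card_isotropicD.
have -> : #|[pred u | (u \in U) && (<|u, u|> == 0)]| = #|isotropic U|.
  by apply: eq_card => w; rewrite !inE.
have -> : #|[pred u | (u \in U) && (<|u, u|> != 0)]| = #|anisotropic U|.
  by apply: eq_card => w; rewrite !inE.
by rewrite muln1 mulnDr mulSn mulnC addnAC.
Qed.

(** The isotropic vectors form a cone over a nondegenerate Hermitian variety of
    an m-dimensional space, with the l-dimensional radical as vertex; the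
    induction splits off one anisotropic vector at a time.  The factor q on the
    left avoids the exponent 2 l + m - 1, which is negative for m = l = 0. *)
Lemma card_isotropic (m l : nat) U :
  \dim U = (m + l)%N -> \dim (hhull q U) = l ->
  (q * #|isotropic U|)%:R =
    Q ^+ (2 * (m + l)) + (-1) ^+ m * (Q - 1) * Q ^+ (2 * l + m).
Proof.
elim: m U => [|m IHm] U dimU hullU.
  have UU : (hhull q U == U) by rewrite eqEdim hhull_sub hullU dimU add0n leqnn.
  have -> : isotropic U = [set v | v \in U].
    apply/setP => v; rewrite !inE andb_idr // => vU.
    have : v \in (U :&: hdual q U)%VS by rewrite [(_ :&: _)%VS](eqP UU).
    by case/memv_capP => _ /hdualP/(_ v vU)->.
  by rewrite card_in_vspace natrM !natrX -exprM dimU add0n addn0; ring.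
have /exists_anisotropic[v vU vv0] : ~~ (U <= hdual q U)%VS.
  apply/negP => UhU; suff: \dim (hhull q U) = \dim U by lia.
  by congr (\dim _); apply/capv_idPl.
pose U' := (U :&: hdual q <[v]>)%VS.
have UE : (U' + <[v]>)%VS = U by rewrite capv_add_lineK.
have vU' : v \in hdual q U' by rewrite memvE hdual_sub capvSr.
have dimU' : \dim U' = (m + l)%N.
  by have := dim_cap_perp U v v vU vv0; rewrite -/U'; lia.
have hullU' : \dim (hhull q U') = l.
  by rewrite -hullU -[in RHS]UE hhull_add_anisotropic.
have := card_isotropic_split U' v vU' vv0.
rewrite UE dimU' => /(congr1 (fun k => k%:R : rat)).
have := IHm U' dimU' hullU'.
rewrite natrD !natrM natrX natrX -exprM => IH /(canRL (addrK _)) ->.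
rewrite mulrBr IH -addn1 natrD exprS.
have -> : (2 * (m.+1 + l) = 2 * (m + l) + 2)%N by lia.
have -> : (2 * l + m.+1 = 2 * l + m + 1)%N by lia.
by rewrite !exprD; ring.
Qed.

Lemma card_anisotropic (m l : nat) U :
  \dim U = (m + l)%N -> \dim (hhull q U) = l ->
  #|anisotropic U|%:R
    = (Q - 1) * Q ^+ (2 * l + m) * (Q ^+ m - (-1) ^+ m) / Q.
Proof.
move=> dimU hullU; apply: (canRL (mulfK Q_neq0)); rewrite mulrC.
have := card_isotropicD U.
rewrite dimU => /(congr1 (fun k => k%:R : rat)).
rewrite natrD natrX natrX -exprM => /(canRL (addKr _)) ->.
rewrite mulrDr mulrN -natrM (card_isotropic m l) //.
have -> : (2 * (m + l) = m + (2 * l + m))%N by lia.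
by rewrite exprD; ring.
Qed.

(** * Two double counts *)

Lemma mem_hdual_capr C u : u \in hdual q (C :&: hdual q <[u]>).
Proof. by rewrite memvE hdual_sub capvSr. Qed.

(** Both sides count pairs: an anisotropic v together with a space containing
    it, or with a space orthogonal to it.  The two kinds of pairs correspond
    through C |-> C cap v^perp and W |-> W + <v>, which preserve the hull. *)
Lemma count_anisotropic_extensions (k l : nat) (cC cW : rat) :
  (forall C, \dim C = k.+1 -> \dim (hhull q C) = l ->
     #|anisotropic C|%:R = cC) ->
  (forall W, \dim W = k -> \dim (hhull q W) = l ->
     #|anisotropic (hdual q W)|%:R = cW) ->
  (AH F n k.+1 l q)%:R * cC = (AH F n k l q)%:R * cW.
Proof.
move=> cardC cardW.
pose P d D := (\dim D == d) && (\dim (hhull q D) == l).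
have <- := @card_dep_pairs_const _ _ (P k.+1)
  (fun C => [pred v | v \in anisotropic C]) cC.
  have <- := @card_dep_pairs_const _ _ (P k)
    (fun W => [pred v | v \in anisotropic (hdual q W)]) cW.
    pose f (x : {vspace 'rV[F]_n} * 'rV[F]_n) :=
      ((x.1 :&: hdual q <[x.2]>)%VS, x.2).
    pose g (x : {vspace 'rV[F]_n} * 'rV[F]_n) := ((x.1 + <[x.2]>)%VS, x.2).
    congr _%:R; apply: (card_eq_inverse f g) => [] [D v];
      rewrite !inE /f /g /P /=.
      case/and3P => /andP[/eqP dimD /eqP hullD] vD vv0.
      have DE := capv_add_lineK D v v vD vv0.
      rewrite DE vv0 mem_hdual_capr !andbT; split=> //.
      have := dim_cap_perp D v v vD vv0; rewrite dimD => -[->].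
      by rewrite -(hhull_add_anisotropic _ v) ?mem_hdual_capr // DE hullD !eqxx.
    case/and3P => /andP[/eqP dimD /eqP hullD] vD vv0.
    have vND : v \notin D.
      by apply: contra vv0 => /(hdualP vD)->.
    rewrite vv0 dim_add_line // dimD hhull_add_anisotropic // hullD !eqxx.
    rewrite add_line_capK //; last by rewrite hdual_sub -memvE.
    by rewrite (subvP (addvSr _ _)) ?memv_line.
  by move=> W /andP[/eqP dimW /eqP hullW]; rewrite -(cardW W) // cardsE.
by move=> C /andP[/eqP dimC /eqP hullC]; rewrite -(cardC C) // cardsE.
Qed.

Definition isotropic_outside W :=
  [set v in isotropic (hdual q W) | v \notin W].

Definition hull_nonzero D := [set v in hhull q D | v != 0].

(** Since an isotropic v is not transverse to its own orthogonal, recovering W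
    from D = W + <v> requires an auxiliary vector u with <v, u> <> 0: then
    W = D cap u^perp.  Including u in the data on both sides gives a
    bijection, at the cost of counting the possible u. *)
Lemma count_isotropic_extensions (k l : nat) (cD cW : rat) :
  (forall D, \dim D = k.+1 -> \dim (hhull q D) = l.+1 ->
     #|nonperp_pairs (hull_nonzero D) fullv|%:R = cD) ->
  (forall W, \dim W = k -> \dim (hhull q W) = l ->
     #|nonperp_pairs (isotropic_outside W) (hdual q W)|%:R = cW) ->
  (AH F n k.+1 l.+1 q)%:R * cD = (AH F n k l q)%:R * cW.
Proof.
move=> cardD cardW.
pose P d r D := (\dim D == d) && (\dim (hhull q D) == r).
have <- := @card_dep_pairs_const _ _ (P k.+1 l.+1)
  (fun D => [pred x | x \in nonperp_pairs (hull_nonzero D) fullv]) cD.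
  have <- := @card_dep_pairs_const _ _ (P k l)
    (fun W =>
       [pred x | x \in nonperp_pairs (isotropic_outside W) (hdual q W)]) cW.
    pose f (x : {vspace 'rV[F]_n} * ('rV[F]_n * 'rV[F]_n)) :=
      ((x.1 :&: hdual q <[x.2.2]>)%VS, x.2).
    pose g (x : {vspace 'rV[F]_n} * ('rV[F]_n * 'rV[F]_n)) :=
      ((x.1 + <[x.2.1]>)%VS, x.2).
    congr _%:R; apply: (card_eq_inverse f g) => [] [D [v u]];
      rewrite !inE /f /g /P /=.
      case/and3P => /andP[/eqP dimD /eqP hullD] /andP[/memv_capP[vD vhD] v0].
      case/andP => _ vu0.
      have DE := capv_add_lineK D u v vD vu0.
      have vv0 : <|v, v|> = 0 by move/hdualP: vhD; apply.
      have := dim_cap_perp D u v vD vu0; rewrite dimD.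
      have := mem_hdual_capr D u.
      have : v \in hdual q (D :&: hdual q <[u]>).
        rewrite memvE hdual_sub (subv_trans (capvSl _ _)) //.
        by rewrite hdual_sub -memvE.
      have : v \notin (D :&: hdual q <[u]>)%VS.
        by rewrite memv_cap mem_hdual_line hdot_eq0C (negbTE vu0) andbF.
      move: (D :&: hdual q <[u]>)%VS DE => W DE vNW vhW uhW [dimW].
      rewrite DE vu0 uhW vhW vv0 dimW eqxx vNW !andbT; split=> //.
      move: hullD; rewrite -DE hhull_add_isotropic // dim_add_line => [[->]|].
        by rewrite !eqxx.
      by apply: contra vNW; apply/subvP/hhull_sub.
    case/and3P => /andP[/eqP dimW /eqP hullW] /andP[/andP[vW /eqP vv0] vNW].
    case/andP => uW vu0; rename D into W.
    rewrite vu0 memvf dim_add_line // dimW.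
    rewrite hhull_add_isotropic // dim_add_line; last first.
      by apply: contra vNW; apply/subvP/hhull_sub.
    rewrite hullW !eqxx add_line_capK //; last by rewrite hdual_sub -memvE.
    rewrite (subvP (addvSr _ _)) ?memv_line //; split=> //=; rewrite andbT.
    by apply: contraNneq vNW => ->; rewrite mem0v.
  by move=> W /andP[/eqP dimW /eqP hullW]; rewrite -(cardW W) // cardsE.
by move=> D /andP[/eqP dimD /eqP hullD]; rewrite -(cardD D) // cardsE.
Qed.

(** All of W cap W^perp = Hull W is isotropic, so the count is that of the
    isotropic vectors of W^perp, less q^(2l); the difference factors. *)
Lemma card_isotropic_outside (m l : nat) W :
  \dim (hdual q W) = (m + l)%N -> \dim (hhull q W) = l ->
  #|isotropic_outside W|%:R
    = Q ^+ (2 * l) * (Q ^+ m - (-1) ^+ m) * (Q ^+ m + (-1) ^+ m * Q) / Q.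
Proof.
move=> dimW hullW; apply: (canRL (mulfK Q_neq0)); rewrite mulrC.
have := cardsID [set v | v \in W] (isotropic (hdual q W)).
have -> : isotropic (hdual q W) :&: [set v | v \in W]
        = [set v | v \in hhull q W].
  apply/setP => v; rewrite !inE memv_cap andbC.
  case: (boolP (v \in W)) => //= vW.
  by case: (boolP (v \in _)) => //= /hdualP/(_ v vW)->; rewrite eqxx.
have -> : isotropic (hdual q W) :\: [set v | v \in W]
        = isotropic_outside W.
  by apply/setP => v; rewrite !inE andbC.
rewrite card_in_vspace hullW => /(congr1 (fun k => k%:R : rat)).
rewrite natrD natrX natrX -exprM => /(canRL (addKr _)) ->.
rewrite mulrDr mulrN -natrM (card_isotropic m l) //; last first.
  by rewrite hhull_hdual.
have -> : (2 * (m + l) = m + m + (2 * l))%N by lia.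
have e2 : (-1) ^+ m * (-1) ^+ m = 1 :> rat.
  by rewrite -exprMn mulrNN mulr1 expr1n.
rewrite (exprD _ (m + m)) (exprD _ m m) (exprD _ (2 * l) m).
move: ((-1) ^+ m) (Q ^+ m) (Q ^+ (2 * l)) e2 => s x y s2.
have -> : y * (x - s) * (x + s * Q) = y * (x * x + s * (Q - 1) * x - s * s * Q).
  by ring.
by rewrite s2; ring.
Qed.

Lemma card_hull_nonzero D :
  #|hull_nonzero D|%:R = Q ^+ (2 * \dim (hhull q D)) - 1.
Proof.
have := cardsD1 0 [set v | v \in hhull q D].
rewrite card_in_vspace inE mem0v => /(congr1 (fun k => k%:R : rat)).
rewrite natrD natrX natrX -exprM => ->; rewrite addrAC subrr add0r.
by congr _%:R; apply: eq_card => v; rewrite !inE andbC.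
Qed.

(** Here k + 1 is the dimension of the codes counted and a' + 1 is the
    parameter a, so that k is the dimension of the auxiliary spaces W. *)
Lemma AH_hull_recurrence (k l : nat) (a' b : nat) :
  k = (l + a')%N -> n = (k.+1 + l + b)%N ->
  (AH F n k.+1 l q)%:R * (Q ^+ a'.+1 - (-1) ^+ a'.+1) * (Q ^+ b - (-1) ^+ b)
  = Q ^+ (a' + b) * (Q ^+ (2 * l.+1) - 1) * (AH F n k.+1 l.+1 q)%:R.
Proof.
move=> kE nE.
have E1 : (AH F n k.+1 l q)%:R
      * ((Q - 1) * Q ^+ (2 * l + a'.+1) * (Q ^+ a'.+1 - (-1) ^+ a'.+1) / Q)
    = (AH F n k l q)%:R
      * ((Q - 1) * Q ^+ (2 * l + b.+1) * (Q ^+ b.+1 - (-1) ^+ b.+1) / Q).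
  apply: count_anisotropic_extensions => [C dimC hullC | W dimW hullW].
    by apply: card_anisotropic => //; lia.
  apply: card_anisotropic; last by rewrite hhull_hdual.
  by rewrite dim_hdual; lia.
have E2 : (AH F n k.+1 l.+1 q)%:R
      * ((Q ^+ (2 * l.+1) - 1) * (Q ^+ (2 * n) * (1 - Q ^- 2)))
    = (AH F n k l q)%:R
      * (Q ^+ (2 * l) * (Q ^+ b.+1 - (-1) ^+ b.+1)
           * (Q ^+ b.+1 + (-1) ^+ b.+1 * Q) / Q
         * (Q ^+ (2 * (b.+1 + l)) * (1 - Q ^- 2))).
  apply: count_isotropic_extensions => [D dimD hullD | W dimW hullW].
    rewrite card_nonperp_pairs ?dimv_rV ?card_hull_nonzero ?hullD //.
    by move=> v; rewrite inE hdual_fullv memv0 => /andP[].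
  have dimhW : \dim (hdual q W) = (b.+1 + l)%N by rewrite dim_hdual; lia.
  rewrite card_nonperp_pairs ?dimhW ?(card_isotropic_outside b.+1 l) //.
  by move=> v; rewrite inE hdualK => /andP[].
(* It remains to eliminate P between E1 and E2. *)
set A := (AH F n k.+1 l q)%:R in E1 *.
set A' := (AH F n k.+1 l.+1 q)%:R in E2 *.
set P := (AH F n k l q)%:R in E1 E2; move: A A' P E1 E2 => A A' P E1 E2.
have Q1 : Q - 1 != 0 by rewrite subr_eq0 gt_eqF // Q_gt1.
have QV2 : 1 - Q ^- 2 != 0.
  rewrite subr_eq0 eq_sym -[1]invr1 (inj_eq invr_inj) gt_eqF //.
  by rewrite exprn_egt1 // Q_gt1.
have sgn (m : nat) : (-1) ^+ m.+1 = - (-1) ^+ m :> rat by rewrite exprS mulN1r.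
have nkE : (2 * n = 2 * (b.+1 + l) + (2 * l + (a' + a')))%N by lia.
rewrite !(exprD _ (2 * l)) ![Q ^+ b.+1]exprS ![Q ^+ a'.+1]exprS !sgn in E1.
rewrite nkE (exprD _ (2 * _)) (exprD _ (2 * l)) (exprD _ a' a') in E2.
rewrite !(exprS Q b) !sgn in E2.
rewrite (exprD _ a' b) (exprS Q a') sgn.
move: (Q ^+ (2 * l.+1) - 1) E2 => G E2.
have W0 : Q ^+ (2 * (b.+1 + l)) * (1 - Q ^- 2) != 0.
  by rewrite mulf_neq0 ?expf_neq0.
rewrite -mulrA in E2.
move: (1 - Q ^- 2) QV2 (Q ^+ (2 * (b.+1 + l))) W0 E2 => V V0 W W0 E2.
have : Q ^+ (2 * l) != 0 by rewrite expf_neq0.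
have : Q ^+ a' != 0 by rewrite expf_neq0.
have : Q ^+ b != 0 by rewrite expf_neq0.
move: (Q ^+ (2 * l)) (Q ^+ a') (Q ^+ b) ((-1) ^+ a') ((-1) ^+ b) E1 E2.
move=> x y z s t E1 E2 z0 y0 x0.
have {}E1 : A * y * (Q * y + s) = P * z * (Q * z + t).
  apply: (mulfI (mulf_neq0 Q1 x0)).
  by transitivity (A * ((Q - 1) * (x * (Q * y)) * (Q * y - - s) / Q));
    [ | rewrite E1]; field.
have {}E2 : A' * G * (y * y) = P * (Q * z + t) * (z - t).
  apply: (mulfI (mulf_neq0 x0 W0)).
  transitivity (A' * (G * ((W * (x * (y * y))) * V))); first by ring.
  by rewrite -[W * _ * V]mulrA E2; field.
apply: (mulfI y0).
transitivity (A * y * (Q * y + s) * (z - t)); first by ring.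
rewrite E1; transitivity (z * (A' * G * (y * y))); last by ring.
by rewrite E2; ring.
Qed.

End HermitianSpace.

(** * The size of alpha *)

Section AlphaBounds.

Lemma alphaHE (n k l q a b : nat) : k = (l + a.+1)%N -> n = (k + l + b.+1)%N ->
  alphaH n k l q = q%:R ^+ (a + b).+1 * (q%:R ^+ l.+1 + 1)
    / ((q%:R ^+ a.+1 - (-1) ^+ a.+1) * (q%:R ^+ b.+1 - (-1) ^+ b.+1)).
Proof.
move=> kE nE; rewrite /alphaH.
have -> : (n - k - l = b.+1)%N by lia.
have -> : (k - l = a.+1)%N by lia.
by have -> : (n - 2 * l - 1 = (a + b).+1)%N by lia.
Qed.

Variable (q : nat).
Hypothesis q_gt1 : (1 < q)%N.
Local Notation Q := (q%:R : rat).

Let Q_ge2 : 2 <= Q.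
Proof. by rewrite ler_nat. Qed.

Let Q_gt0 : 0 < Q.
Proof. by rewrite (lt_le_trans _ Q_ge2). Qed.

Lemma expQ_ge1 (m : nat) : 1 <= Q ^+ m.
Proof. by rewrite exprn_ege1 // (le_trans _ Q_ge2). Qed.

Lemma expQ_sign_gt0 (m : nat) : 0 < Q ^+ m.+1 - (-1) ^+ m.+1.
Proof.
have := expQ_ge1 m; have := Q_ge2; rewrite exprS -signr_odd.
by case: (odd _); rewrite ?expr0 ?expr1; nra.
Qed.

Lemma sign_cases (m : nat) :
  (-1) ^+ m = (if odd m then -1 else 1) :> rat.
Proof. by rewrite -signr_odd; case: odd. Qed.

(** The parameters a and b are the successors of those quantified here, so
    odd a below means that the parameter is even, and 1 < a that it is at
    least 3.  For l > 0 both signs can be taken to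
    be the worst ones, and q^(l+1) >= q^2 makes up for them; for l = 0 an even
    parameter contributes a factor less than its power of q. *)
Lemma alphaH_gt1 (n k l a b : nat) :
  k = (l + a.+1)%N -> n = (k + l + b.+1)%N ->
  [|| (0 < l)%N, odd a, odd b | (1 < a)%N && (1 < b)%N] ->
  1 < alphaH n k l q.
Proof.
move=> kE nE; rewrite (alphaHE _ _ _ _ _ _ kE nE).
rewrite ltr_pdivlMr ?mulr_gt0 ?expQ_sign_gt0 // mul1r !sign_cases.
rewrite (exprS Q (a + b)) (exprD Q a b) (exprS Q a) (exprS Q b) /=.
have := expQ_ge1 a; have := expQ_ge1 b; have := Q_ge2.
case: (posnP l) => [-> | l_gt0] /=; last first.
  move=> + + + _.
  have : Q ^+ 2 <= Q ^+ l.+1 by rewrite ler_eXn2l // (lt_le_trans _ Q_ge2).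
  move: (Q ^+ l.+1) (Q ^+ a) (Q ^+ b) => z x y zQ Q2 y1 x1.
  have xy1 : x + y <= x * y + 1 by nra.
  have : (Q * x - (if ~~ odd a then -1 else 1))
         * (Q * y - (if ~~ odd b then -1 else 1)) <= (Q * x + 1) * (Q * y + 1).
    by apply: ler_pM; case: (odd a); case: (odd b) => /=; nra.
  move/le_lt_trans; apply.
  have xy : 1 <= x * y by nra.
  have : Q * (x * y) * (Q ^+ 2 + 1) <= Q * (x * y) * (z + 1).
    by rewrite ler_pM2l ?lerD2r //; nra.
  apply: lt_le_trans.
  have : Q * (x + y) <= Q * (x * y + 1) by rewrite ler_pM2l.
  have : 2 * (Q * (x * y)) <= Q * (Q * (x * y)) by rewrite ler_pM2r //; nra.
  have : 2 * (Q * (Q * (x * y))) <= Q * (Q * (Q * (x * y))).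
    by rewrite ler_pM2r //; nra.
  have : 2 <= Q * (x * y) by nra.
  have : Q <= Q * (x * y) by nra.
  by rewrite expr2; nra.
rewrite expr1; case: (boolP (odd a)) => [oa | ea] /=.
  move: (Q ^+ a) (Q ^+ b) => x y Q2 y1 x1 _.
  have xy : x <= x * y by nra.
  have : Q * x <= Q * (x * y) by rewrite ler_pM2l.
  by case: odd => /=; nra.
case: (boolP (odd b)) => [ob | eb] /=.
  move: (Q ^+ a) (Q ^+ b) => x y Q2 y1 x1 _.
  have xy : y <= x * y by nra.
  have : Q * y <= Q * (x * y) by rewrite ler_pM2l.
  by nra.
move=> Q2 _ _ /andP[a1 b1].
have e4 (m : nat) : (1 < m)%N -> 4 <= Q ^+ m.
  move=> m1; apply: (@le_trans _ _ (Q ^+ 2)); first by rewrite expr2; nra.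
  by rewrite ler_eXn2l // (lt_le_trans _ Q_ge2).
have := e4 a a1; have := e4 b b1; move: (Q ^+ a) (Q ^+ b) => x y y4 x4.
have xy : 2 * (x + y) <= x * y by nra.
have : Q * (2 * (x + y)) <= Q * (x * y) by rewrite ler_pM2l.
by nra.
Qed.

(** One parameter is 1 and contributes the factor q + 1, which cancels with
    the factor q^(l+1) + 1 of the numerator; m + 1 is the other parameter. *)
Lemma alphaH_exceptional (n k m : nat) : ~~ odd m -> n = m.+2 ->
  k = 1%N \/ k = m.+1 ->
  alphaH n k 0 q = Q ^+ m.+1 / (Q ^+ m.+1 + 1).
Proof.
move=> em nE kE.
have Q10 : Q + 1 != 0 by rewrite gt_eqF // addr_gt0.
have D0 : Q ^+ m.+1 + 1 != 0 by rewrite gt_eqF // addr_gt0 // exprn_gt0.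
case: kE => kE.
  rewrite (alphaHE n k 0 q 0 m); try lia.
  rewrite !sign_cases /= em expr1 !opprK add0n; field.
  by rewrite D0.
rewrite (alphaHE n k 0 q m 0); try lia.
rewrite !sign_cases /= em expr1 !opprK addn0; field.
by rewrite D0.
Qed.

Lemma exceptional_value_bounds (m : nat) :
  Q / (Q + 1) <= Q ^+ m.+1 / (Q ^+ m.+1 + 1) < 1.
Proof.
have x1 := expQ_ge1 m; have Q2 := Q_ge2; rewrite exprS.
move: (Q ^+ m) x1 => x x1.
have x0 : 0 < Q * x + 1 by nra.
apply/andP; split; last by rewrite ltr_pdivrMr // mul1r ltrDl.
rewrite ler_pdivrMr ?addr_gt0 // mulrAC ler_pdivlMr //.
have : Q * 1 <= Q * x by rewrite ler_pM2l.
by nra.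
Qed.

Lemma two_thirds_le : 2 / 3 <= Q / (Q + 1).
Proof.
have Q2 := Q_ge2; rewrite ler_pdivlMr ?addr_gt0 //.
by rewrite mulrAC ler_pdivrMr //; nra.
Qed.

End AlphaBounds.

Theorem theorem9 (p e q n k l : nat)
    (p_prime : prime p) (e_gt0 : (0 < e)%N) (qE : q = (p ^ e)%N)
    (lk : (l + 1 <= k)%N) (kln : (k + l + 1 <= n)%N) :
  let a := (k - l)%N in
  let b := (n - k - l)%N in
  let exceptional := l = 0%N /\ (odd a /\ odd b) /\ minn a b = 1%N in
  (forall F : finFieldType, #|F| = (q ^ 2)%N ->
    (AH F n k l q)%:R =
      alphaH n k l q * (q%:R ^+ (l + 1) - 1) * (AH F n k (l + 1) q)%:R)
  /\ (~ exceptional -> 1 < alphaH n k l q)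
  /\ (exceptional <-> l = 0%N /\ ~~ odd n /\ (k = 1%N \/ k = (n - 1)%N))
  /\ (exceptional ->
        alphaH n k 0 q = q%:R ^+ maxn a b / (q%:R ^+ maxn a b + 1)
        /\ q%:R / (q%:R + 1) <= alphaH n k 0 q
        /\ alphaH n k 0 q < 1)
  /\ (q%:R / (q%:R + 1) <= alphaH n k l q /\ (2 / 3 : rat) <= q%:R / (q%:R + 1)).
Proof.
move=> a b exceptional.
have q1 : (1 < q)%N := q_gt1 p e q p_prime e_gt0 qE.
have kE : k = (l + a.-1.+1)%N by rewrite /a; lia.
have nE : n = (k + l + b.-1.+1)%N by rewrite /b; lia.
have excE : exceptional <-> l = 0%N /\ ~~ odd n /\ (k = 1%N \/ k = (n - 1)%N).
  by rewrite /exceptional /a /b; split; lia.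
have gt1 : ~ exceptional -> 1 < alphaH n k l q.
  move=> nexc; apply: (alphaH_gt1 q q1 _ _ _ _ _ kE nE).
  by apply/negPn/negP => bad; apply: nexc; rewrite /exceptional; lia.
have exc : exceptional ->
    alphaH n k 0 q = q%:R ^+ maxn a b / (q%:R ^+ maxn a b + 1)
    /\ q%:R / (q%:R + 1) <= alphaH n k 0 q /\ alphaH n k 0 q < 1.
  move=> exc; have [m mE] : exists m, maxn a b = m.+1.
    by exists (maxn a b).-1; lia.
  have {}mE : n = m.+2 /\ maxn a b = m.+1 /\ ~~ odd m.
    by move: exc; rewrite /exceptional /a /b in mE *; lia.
  have [_ [_ kE']] := excE.1 exc.
  have aE : alphaH n k 0 q = q%:R ^+ m.+1 / (q%:R ^+ m.+1 + 1).
    by apply: (alphaH_exceptional q q1); [case: mE => _ [] | case: mE | lia].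
  by rewrite mE.2.1 aE; have /andP[-> ->] := exceptional_value_bounds q q1 m.
split; last first.
  split=> //; split=> //; split=> //; split; last exact: two_thirds_le q q1.
  case: (boolP [&& l == 0%N, odd a, odd b & minn a b == 1%N]) => [ex | nex].
    have ex' : exceptional by rewrite /exceptional; lia.
    by rewrite (proj1 ex'); have [_ []] := exc ex'.
  have /ltW : 1 < alphaH n k l q by apply: gt1; rewrite /exceptional; lia.
  apply: le_trans; have /andP[le1 lt1] := exceptional_value_bounds q q1 0.
  exact: ltW (le_lt_trans le1 lt1).
move=> F cardF.
have := AH_hull_recurrence F p e q n p_prime e_gt0 qE cardF k.-1 l a.-1 b.-1.+1.
rewrite (prednK (_ : 0 < k)%N); last by lia.
move=> /(_ ltac:(lia) ltac:(lia)).
rewrite (alphaHE _ _ _ _ _ _ kE nE) addn1 addnS.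
have Da := expQ_sign_gt0 q q1 a.-1; have Db := expQ_sign_gt0 q q1 b.-1.
rewrite mulnC exprM => step; apply: (mulIf (lt0r_neq0 Da)).
apply: (mulIf (lt0r_neq0 Db)); rewrite step; field.
by rewrite !lt0r_neq0.
Qed.
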